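(* Let $K_r$ be the quiver with two vertices $1,2$ and $r$ arrows from $1$ to $2$, with mutation sequence $1,2,1,2,\dots$. Let $\mathcal W$ be the set of (possibly empty) sequences $\mathbf w=(w_1,\dots,w_k)$ of integers with $1\le w_1\le\cdots\le w_k\le n$. Then $$F_n=\sum_{\mathbf w\in\mathcal W}\phi(\mathbf w)\prod_{i=1}^k\Big(s_{n-w_i}-\sum_{j=i+1}^k\big(s_{w_j-w_i}+s_{w_j-w_i-2}\big)\Big)\,y_1^{\sum_{i=1}^ks_{w_i-1}}\,y_2^{\sum_{i=1}^ks_{w_i-2}}.$$
   Context: Quiver mutation at $k$: for every path $i\to k\to j$ add an arrow $i\to j$, reverse all arrows incident to $k$, then delete all 2-cycles. The framed quiver has additional frozen vertices $i'$ with one arrow $i'\to i$ for each base vertex $i$; only base vertices are mutated. Initially each base vertex has label $1$ and $i'$ has label $y_i$; mutating at $k$ replaces the label $V_k$ by (product of labels over arrows into $k$ + product of labels over arrows out of $k$, with multiplicity)$/V_k$. The $F$-polynomial $F_n$ is the label at the vertex mutated at step $n$, right after step $n$. The sequence $s$: $s_m=0$ for $m<0$, $s_0=1$, and $s_{k+2}=rs_{k+1}-s_k$ for $k\ge-1$. $\phi(\mathbf w)$ is the number of distinct permutations of $w_1,\dots,w_k$ divided by $k!$ (so $\phi=1$ for the empty sequence, whose products are $1$). The sum is taken coefficientwise as a formal power series in $y_1,y_2$.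
   Formalization: The formal theorem takes n ≥ 1 and assumes s_m ≥ 0 for 0 ≤ m < n (automatic for r ≥ 2); without it the sum has negative exponents and is no power series, e.g. r = 1, n = 4 gives a term y_1^{-1} while F_4 = 1. *)

(* Defs.v *)
From mathcomp Require Import all_boot all_order all_algebra.
From mathcomp Require Export mpoly.

Set Implicit Arguments.
Unset Strict Implicit.
Unset Printing Implicit Defensive.

Import Order.TTheory GRing.Theory Num.Theory.
Local Open Scope ring_scope.

Section Quiver.
Variable V : finType.

(* A quiver is given by its arrow multiplicities: [q i j] is the number of
   arrows from [i] to [j]. *)
Definition quiver := V -> V -> nat.

Definition add_paths (k : V) (q : quiver) : quiver :=
  fun i j => (q i j + q i k * q k j)%N.

Definition reverse_at (k : V) (q : quiver) : quiver :=
  fun i j => if (i == k) || (j == k) then q j i else q i j.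

(* Truncated subtraction: min (q i j) (q j i) two-cycles are removed. *)
Definition delete_2cycles (q : quiver) : quiver :=
  fun i j => (q i j - q j i)%N.

Definition mutate_quiver (k : V) (q : quiver) : quiver :=
  delete_2cycles (reverse_at k (add_paths k q)).

Variable K : fieldType.

Definition mutate_labels (k : V) (q : quiver) (x : V -> K) : V -> K :=
  fun v => if v == k
           then (\prod_u x u ^+ q u k + \prod_u x u ^+ q k u) / x k
           else x v.

Definition mutate (k : V) (S : quiver * (V -> K)) : quiver * (V -> K) :=
  (mutate_quiver k S.1, mutate_labels k S.1 S.2).

End Quiver.

Section FPolynomial.
Variable N : nat.

(* [inl i] is the base vertex i and [inr i] is the frozen vertex i'. *)
Definition framed (q : quiver 'I_N) : quiver ('I_N + 'I_N)%type :=
  fun a b => match a, b with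
             | inl i, inl j => q i j
             | inr i, inl j => (i == j : nat)
             | _, inr _ => 0%N
             end.

Definition initial_labels (a : 'I_N + 'I_N) : {fraction {mpoly rat[N]}} :=
  match a with
  | inl _ => 1
  | inr i => tofrac ('X_i : {mpoly rat[N]})
  end.

(* [mu t], for t >= 1, is the base vertex mutated at step t. *)
Fixpoint seed_after (q : quiver 'I_N) (mu : nat -> 'I_N) (n : nat) :=
  match n with
  | 0 => (framed q, initial_labels)
  | n'.+1 => mutate (inl (mu n)) (seed_after q mu n')
  end.

Definition Fpoly (q : quiver 'I_N) (mu : nat -> 'I_N) (n : nat) :
    {fraction {mpoly rat[N]}} :=
  (seed_after q mu n).2 (inl (mu n)).

End FPolynomial.

Definition v1 : 'I_2 := ord0.
Definition v2 : 'I_2 := ord_max.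

Definition kronecker (r : nat) : quiver 'I_2 :=
  fun i j => if (i == v1) && (j == v2) then r else 0%N.

Definition alternating (t : nat) : 'I_2 := if odd t then v1 else v2.

(* [s_pair r m] is (s_{m-1}, s_m). *)
Fixpoint s_pair (r m : nat) : int * int :=
  match m with
  | 0 => (0, 1)
  | m'.+1 => let: (a, b) := s_pair r m' in (b, r%:Z * b - a)
  end.

Definition s (r : nat) (z : int) : int :=
  match z with
  | Posz m => (s_pair r m).2
  | Negz _ => 0
  end.

Lemma s_neg (r : nat) (z : int) : z < 0 -> s r z = 0.
Proof. by case: z. Qed.

Lemma s_0 (r : nat) : s r 0 = 1.
Proof. by []. Qed.

Lemma s_rec (r : nat) (k : int) :
  -1 <= k -> s r (k + 2) = r%:Z * s r (k + 1) - s r k.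
Proof.
case: k => [m | [|m]] // _.
rewrite -!PoszD addn2 addn1 /=.
by case: (s_pair r m).
Qed.

Lemma s_ge0 (r : nat) (m : nat) : (2 <= r)%N -> 0 <= s r m%:Z.
Proof.
move=> r2; suff /andP[h1 h2] : (0 <= (s_pair r m).1) &&
    ((s_pair r m).1 <= (s_pair r m).2) by apply: le_trans h1 h2.
elim: m => //= m; case: (s_pair r m) => a b /= /andP[a0 ab].
have b0 := le_trans a0 ab; rewrite b0 lerBrDr /=.
apply: le_trans (_ : 2%:Z * b <= _); last by rewrite ler_wpM2r // lez_nat.
have -> : 2%:Z * b = b + b by rewrite (_ : 2%:Z = 1 + 1) // mulrDl mul1r.
by rewrite lerD2l.
Qed.

Definition phi (w : seq nat) : rat :=
  (size (permutations w))%:R / (size w)`!%:R.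

Definition in_W (n : nat) (w : seq nat) : bool :=
  sorted leq w && all (fun x => (1 <= x <= n)%N) w.

(* Positions in [w] are counted from 0. *)
Definition factor (r n : nat) (w : seq nat) (i : nat) : int :=
  let w_ j : int := (nth 0%N w j)%:Z in
  s r (n%:Z - w_ i)
  - \sum_(i.+1 <= j < size w) (s r (w_ j - w_ i) + s r (w_ j - w_ i - 2)).

Definition coefficient (r n : nat) (w : seq nat) : rat :=
  phi w * (\prod_(0 <= i < size w) factor r n w i)%:~R.

Definition exponent1 (r : nat) (w : seq nat) : int :=
  \sum_(x <- w) s r (x%:Z - 1).

Definition exponent2 (r : nat) (w : seq nat) : int :=
  \sum_(x <- w) s r (x%:Z - 2).

(* The set A is finite, and f sums to v over it. *)
Definition has_finite_sum (T : eqType) (A : pred T) (f : T -> rat) (v : rat) :=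
  exists ts : seq T, [/\ uniq ts, ts =i A & \sum_(t <- ts) f t = v].

(* The polynomial p is the coefficientwise sum, over the index set A, of the
   terms c t * y_1^(e1 t) * y_2^(e2 t). *)
Definition is_power_series_sum (T : eqType) (A : pred T) (c : T -> rat)
    (e1 e2 : T -> int) (p : {mpoly rat[2]}) :=
  forall m : 'X_{1..2},
    has_finite_sum
      [pred t | [&& A t, e1 t == (m v1)%:Z & e2 t == (m v2)%:Z]] c p@_m.

(* Main.v *)
Require Import Defs.
From mathcomp Require Import all_boot all_order all_algebra.
From mathcomp Require Import zify ring.

(** The Kronecker quiver keeps its shape under alternating mutation, and its
    c-vectors obey the recurrence of [s]. Mutation therefore reduces to
    [F_{m+1} F_{m-1} = F_m^r + z_{m+1}] with
    [z_k = y_1^{s_(k-1)} y_2^{s_(k-2)}] and [F_{-1} = F_0 = 1]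
    ([Fpoly_prevF]).

    Put [L_j = F_j F_{j-2} / F_{j-1}^r = 1 + u_j], where
    [u_j = z_j / F_{j-1}^r]. As [s] is the fundamental solution of the linear
    recurrence satisfied by the exponents, [F_m] is the product over [j <= m] of
    [L_j^{s_(m-j)}] ([prevF_prod]). Substituting this product for [F_{k-1}] gives
    [u_k] as [z_k] times the product over [j < k] of
    [L_j^{- r s_(k-1-j)}], and [r s_(k-1-j) = s_(k-j) + s_(k-j-2)]
    ([wall_term_prod]).

    Now expand [F_n] by the binomial series of [L_n], then of [L_(n-1)], and so
    on. Taking the [m]-th term of the series of [L_k] multiplies by [z_k^m],
    by a binomial coefficient whose upper entry is the current exponent of
    [L_k], and changes the exponents of the earlier [L_j] by
    [- m (s_(k-j) + s_(k-j-2))]. When all factors are expanded there is one term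
    for each choice of multiplicities, that is for each weakly increasing word,
    and the product of its binomial coefficients is the stated coefficient
    because the permutations of a word are counted by a multinomial coefficient
    ([coefficient_block]).

    The series are handled inside the field of fractions: [vanishes D f] says
    that [f] expands at the origin to a series of order at least [D], and each
    expansion is an equality modulo such elements ([binomial_expansion],
    [prevF_expansion]). A coefficient of degree less than [D] of a polynomial is
    determined modulo them ([vanishes_tofracP]). That [F_n] is a polynomial is the
    Laurent phenomenon in rank two ([exchange_divides], [prevF_poly]). *)

Set Implicit Arguments.
Unset Strict Implicit.
Unset Printing Implicit Defensive.

Import Order.TTheory GRing.Theory Num.Theory.
Local Open Scope ring_scope.

(** * Order of vanishing at the origin *)

Section LocalRing.
Variable N : nat.
Local Notation poly := {mpoly rat[N]}.
Local Notation K := {fraction poly}.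
Implicit Types (p q a b : poly) (f g u : K) (D : nat).

Definition low_order D p := forall m, (mdeg m < D)%N -> p@_m = 0.

(** Congruences of power series without power series: quotients of polynomials
    whose denominator has constant coefficient 1 are the elements that expand at
    the origin, and those with a numerator of order at least [D] expand to
    series of order at least [D]. *)
Definition vanishes D f :=
  exists a b, [/\ low_order D a, b@_0%MM = 1 & f = tofrac a / tofrac b].

Definition principal_unit f :=
  exists a b, [/\ a@_0%MM = 1, b@_0%MM = 1 & f = tofrac a / tofrac b].

Lemma low_orderD D p q : low_order D p -> low_order D q -> low_order D (p + q).
Proof. by move=> hp hq m hm; rewrite mcoeffD hp // hq // addr0. Qed.

Lemma low_orderM D E p q :
  low_order D p -> low_order E q -> low_order (D + E) (p * q).
Proof.
move=> hp hq m hm; rewrite mcoeffM big1 // => k /eqP Dm.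
have [lt1|ge1] := ltnP (mdeg k.1) D; first by rewrite hp // mul0r.
rewrite [q@__]hq ?mulr0 //.
have degm := congr1 mdeg Dm; rewrite mdegD in degm.
by rewrite -(ltn_add2l (mdeg k.1)) -degm (leq_trans hm) // leq_add2r.
Qed.

Lemma low_order1 p : p@_0%MM = 0 -> low_order 1 p.
Proof. by move=> p0 m; rewrite ltnS leqn0 mdeg_eq0 => /eqP->. Qed.

Lemma mcoeff0_mul p q : (p * q)@_0%MM = p@_0%MM * q@_0%MM.
Proof. exact: (rmorphM (mcoeff 0%MM)). Qed.

Lemma mcoeff0_exp p k : (p ^+ k)@_0%MM = p@_0%MM ^+ k.
Proof. exact: (rmorphXn (mcoeff 0%MM)). Qed.

Lemma mcoeff0_one : (1 : poly)@_0%MM = 1.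
Proof. by rewrite mcoeff1 eqxx. Qed.

Lemma const1_neq0 p : p@_0%MM = 1 -> tofrac p != 0 :> K.
Proof.
move=> p1; rewrite tofrac_eq0; apply/eqP => p0.
by move/eqP: p1; rewrite p0 mcoeff0 eq_sym oner_eq0.
Qed.

Lemma vanishesD D f g : vanishes D f -> vanishes D g -> vanishes D (f + g).
Proof.
move=> [a [b [ha hb ->]]] [c [d [hc hd ->]]].
exists (a * d + c * b), (b * d); split.
- by apply: low_orderD; rewrite -[D]addn0; apply: low_orderM.
- by rewrite mcoeff0_mul hb hd mulr1.
by rewrite tofracD !tofracM addf_div // const1_neq0.
Qed.

Lemma vanishesM D E f g :
  vanishes D f -> vanishes E g -> vanishes (D + E) (f * g).
Proof.
move=> [a [b [ha hb ->]]] [c [d [hc hd ->]]].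
exists (a * c), (b * d); split; first exact: low_orderM.
- by rewrite mcoeff0_mul hb hd mulr1.
by rewrite !tofracM mulf_div.
Qed.

Lemma vanishes_tofrac D p : low_order D p -> vanishes D (tofrac p).
Proof.
by move=> hp; exists p, 1; split; rewrite ?mcoeff0_one // tofrac1 divr1.
Qed.

Lemma vanishes_poly p : vanishes 0 (tofrac p).
Proof. exact: vanishes_tofrac. Qed.

Lemma vanishes0 D : vanishes D 0.
Proof. by rewrite -tofrac0; apply: vanishes_tofrac => m _; rewrite mcoeff0. Qed.

Lemma vanishesMl D f g : vanishes 0 f -> vanishes D g -> vanishes D (f * g).
Proof. exact: vanishesM. Qed.

Lemma vanishesN D f : vanishes D f -> vanishes D (- f).
Proof.
rewrite -mulN1r -tofrac1 -tofracN; apply: vanishesMl; exact: vanishes_poly.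
Qed.

Lemma vanishesX D f : vanishes 1 f -> vanishes D (f ^+ D).
Proof.
move=> hf; elim: D => [|D IH]; first by rewrite expr0 -tofrac1; apply: vanishes_poly.
by rewrite exprS -add1n; apply: vanishesM.
Qed.

Lemma vanishes_sum D (I : eqType) (t : seq I) (F : I -> K) :
  {in t, forall i, vanishes D (F i)} -> vanishes D (\sum_(i <- t) F i).
Proof.
move=> hF; rewrite big_seq; elim/big_rec: _ => [|i f ti]; first exact: vanishes0.
by apply: vanishesD; apply: hF.
Qed.

Lemma principal_unitM f g :
  principal_unit f -> principal_unit g -> principal_unit (f * g).
Proof.
move=> [a [b [ha hb ->]]] [c [d [hc hd ->]]].
by exists (a * c), (b * d); rewrite !mcoeff0_mul ha hb hc hd !mulr1 !tofracM mulf_div.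
Qed.

Lemma principal_unit1 : principal_unit 1.
Proof. by exists 1, 1; rewrite mcoeff0_one tofrac1 divr1. Qed.

Lemma principal_unitV f : principal_unit f -> principal_unit f^-1.
Proof. by move=> [a [b [ha hb ->]]]; exists b, a; rewrite invf_div. Qed.

Lemma principal_unit_exprz f (e : int) : principal_unit f -> principal_unit (f ^ e).
Proof.
move=> hf; have hX k : principal_unit (f ^+ k).
  elim: k => [|k IH]; first exact: principal_unit1.
  by rewrite exprS; apply: principal_unitM.
by case: e => k; [apply: hX | apply: principal_unitV; apply: hX].
Qed.

Lemma principal_unit_prod (I : eqType) (t : seq I) (F : I -> K) :
  {in t, forall i, principal_unit (F i)} -> principal_unit (\prod_(i <- t) F i).
Proof.
move=> hF; rewrite big_seq; elim/big_rec: _ => [|i f ti].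
  exact: principal_unit1.
by apply: principal_unitM; apply: hF.
Qed.

Lemma principal_unit_neq0 f : principal_unit f -> f != 0.
Proof.
by move=> [a [b [ha hb ->]]]; rewrite mulf_neq0 ?invr_neq0 ?const1_neq0.
Qed.

Lemma principal_unit_vanishes f : principal_unit f -> vanishes 0 f.
Proof. by move=> [a [b [ha hb ->]]]; exists a, b. Qed.

Lemma principal_unit_add1 u : vanishes 1 u -> principal_unit (1 + u).
Proof.
move=> [a [b [ha hb ->]]]; exists (b + a), b; split=> //.
  by rewrite mcoeffD hb ha ?addr0 // mdeg0.
by rewrite tofracD mulrDl divff // const1_neq0.
Qed.

(** For a polynomial the expansion is the polynomial itself. From [a = p * b]
    one gets [p = a + (1 - b) * p], where [1 - b] has no constant term, so the
    order of [p] can be raised one unit at a time until it reaches [D]. *)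
Lemma vanishes_tofracP D p : vanishes D (tofrac p) -> low_order D p.
Proof.
move=> [a [b [ha hb Dp]]].
have Da : a = p * b.
  by apply/eqP; rewrite -tofrac_eq tofracM Dp divfK // const1_neq0.
have hc : low_order 1 (1 - b).
  by apply: low_order1; rewrite mcoeffB mcoeff0_one hb subrr.
suff hk k : (k <= D)%N -> low_order k p by exact: hk.
elim: k => [//|k IH] ltkD.
have -> : p = a + (1 - b) * p by rewrite Da; ring.
apply: low_orderD => [m lt_mk|]; first by apply: ha; lia.
by rewrite -[k.+1]add1n; apply: low_orderM => //; apply: IH; apply: ltnW.
Qed.
End LocalRing.

(** * The binomial series with integer exponent *)

Definition binz (e : int) (m : nat) : rat :=
  (\prod_(i < m) (e - i%:Z))%:~R / m`!%:R.

Lemma binz0 e : binz e 0 = 1.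
Proof. by rewrite /binz big_ord0 divr1. Qed.

Lemma binzS e m : binz (e + 1) m.+1 = binz e m.+1 + binz e m.
Proof.
rewrite /binz big_ord_recl big_ord_recr /= subr0.
rewrite (eq_bigr (fun i : 'I_m => e - i%:Z)) => [|i _]; last first.
  by rewrite /bump /=; lia.
set P := \prod_(i < m) _.
have fm : m`!%:R != 0 :> rat by rewrite pnatr_eq0 -lt0n fact_gt0.
have Sm : m.+1%:R != 0 :> rat by rewrite pnatr_eq0.
rewrite factS natrM !intrM intrB intrD -[m.+1]addn1 natrD in Sm *.
rewrite -[(Posz m)%:~R]/(m%:R); by field; rewrite Sm fm.
Qed.

Lemma binz_nil m : (0 < m)%N -> binz 0 m = 0.
Proof.
by case: m => // m _; rewrite /binz big_ord_recl subrr mul0r mul0r.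
Qed.

Section BinomialSeries.
Variable N : nat.
Local Notation K := {fraction {mpoly rat[N]}}.

Definition constF (c : rat) : K := tofrac c%:MP.

Lemma constFD c d : constF (c + d) = constF c + constF d.
Proof. by rewrite /constF mpolyCD tofracD. Qed.

Lemma constFM c d : constF (c * d) = constF c * constF d.
Proof. by rewrite /constF mpolyCM tofracM. Qed.

Lemma constF0 : constF 0 = 0. Proof. by rewrite /constF mpolyC0 tofrac0. Qed.
Lemma constF1 : constF 1 = 1. Proof. by rewrite /constF mpolyC1 tofrac1. Qed.

Lemma vanishes_constF c : vanishes 0 (constF c).
Proof. exact: vanishes_poly. Qed.

Variables (D : nat) (u : K).

Definition binomial_sum (e : int) : K :=
  \sum_(m < D.+1) constF (binz e m) * u ^+ m.

(** Pascal's rule makes the truncated binomial series multiplicative up to a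
    single boundary term of order [D + 1]. *)
Lemma binomial_sumS e :
  (1 + u) * binomial_sum e =
  binomial_sum (e + 1) + constF (binz e D) * u ^+ D.+1.
Proof.
rewrite /binomial_sum; elim: D => [|k IH].
  by rewrite !big_ord1 !binz0 constF1; ring.
rewrite big_ord_recr mulrDr IH [in RHS]big_ord_recr /= binzS constFD !exprS.
by ring.
Qed.

Lemma binomial_sum0 : binomial_sum 0 = 1.
Proof.
rewrite /binomial_sum big_ord_recl big1 => [|i _]; last first.
  by rewrite binz_nil // constF0 mul0r.
by rewrite binz0 constF1; ring.
Qed.

Hypothesis u_small : vanishes 1 u.

(** Pascal's rule raises the exponent by one modulo order [D + 1]; as [1 + u] is
    a unit it lowers it as well, hence negative exponents need no separate
    theory. *)
Lemma binomial_expansion e : vanishes D.+1 ((1 + u) ^ e - binomial_sum e).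
Proof.
have U := principal_unit_add1 u_small; have nz := principal_unit_neq0 U.
have V0 := principal_unit_vanishes U.
have V0' := principal_unit_vanishes (principal_unitV U).
have step k : vanishes D.+1 (constF (binz k D) * u ^+ D.+1).
  by apply: vanishesMl (vanishes_constF _) _; apply: vanishesX.
elim: e => [|k IH|k IH].
- by rewrite expr0z binomial_sum0 subrr; apply: vanishes0.
- rewrite (_ : k.+1 = k%:Z + 1 :> int); last by lia.
  rewrite expfzDr // expr1z.
  have -> : (1 + u) ^ k * (1 + u) - binomial_sum (k%:Z + 1) =
    (1 + u) * ((1 + u) ^ k - binomial_sum k) + constF (binz k D) * u ^+ D.+1.
    by rewrite mulrBr binomial_sumS; ring.
  by apply: vanishesD (step _); apply: vanishesMl.
set e := - k.+1%:Z; have De : - k%:Z = e + 1 by rewrite /e; lia.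
have -> : (1 + u) ^ e - binomial_sum e = (1 + u)^-1 *
    ((1 + u) ^ (- k%:Z) - binomial_sum (- k%:Z) - constF (binz e D) * u ^+ D.+1).
  apply: (mulfI nz); rewrite mulrA mulfV // mul1r De expfzDr // expr1z.
  by rewrite mulrBr binomial_sumS; ring.
apply: vanishesMl => //; apply: vanishesD => //; exact: vanishesN.
Qed.

End BinomialSeries.

(** * Coefficients of words, block by block *)

(** Counting permutations by their first letter [x]: removing one occurrence of
    [x] divides the product of factorials by the multiplicity of [x], and the
    multiplicities add up to the length. The product runs over a fixed
    superset [u] of the letters because removing an occurrence may exhaust a
    letter. *)
Lemma size_permutations_count (T : eqType) (u w : seq T) :
  uniq u -> {subset w <= u} ->
  (size (permutations w) * \prod_(x <- u) (count_mem x w)`! = (size w)`!)%N.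
Proof.
move=> Uu; elim: {w}(size w) {-2}w (erefl (size w)) => [|k IH] w Dk sub_wu.
  by rewrite (size0nil Dk) big1 ?muln1.
have nt_w : w != [::] by rewrite -size_eq0 Dk.
rewrite (perm_size (permutationsE _)) ?Dk //; rewrite size_allpairs_dep sumnE big_map.
rewrite big_distrl /= (eq_big_seq (fun x => count_mem x w * k`!)%N).
  rewrite -big_distrl /=.
  have := perm_size (perm_count_undup w).
  rewrite size_flatten sumnE !big_map.
  under eq_bigr do rewrite size_nseq.
  by move=> ->; rewrite Dk factS.
move=> x; rewrite mem_undup => wx.
have Drem : perm_eq w (x :: rem x w) by apply: perm_to_rem.
have szrem : size (rem x w) = k by rewrite size_rem // Dk.
have subrem : {subset rem x w <= u} by move=> y /mem_rem/sub_wu.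
have ux := sub_wu x wx.
have := IH _ szrem subrem; rewrite szrem => <-.
rewrite !(big_rem x ux) /=.
have -> : (count_mem x w = (count_mem x (rem x w)).+1)%N.
  by rewrite (permP Drem) /= eqxx.
rewrite factS -!mulnA mulnCA; congr (_ * (_ * (_ * _)))%N.
apply: eq_big_seq => y; rewrite mem_rem_uniq // inE => /andP[/negPf nyx _].
by rewrite (permP Drem) /= eq_sym nyx.
Qed.

Lemma phiE (u w : seq nat) : uniq u -> {subset w <= u} ->
  phi w = (\prod_(x <- u) (count_mem x w)`!)%:R^-1.
Proof.
move=> Uu sub_wu; rewrite /phi -(size_permutations_count Uu sub_wu) natrM.
rewrite invfM mulrA divff ?mul1r // pnatr_eq0 size_eq0.
by apply/eqP => p0; have := mem_permutations w w; rewrite p0 perm_refl.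
Qed.

Lemma phi_block (m k : nat) (w : seq nat) : k \notin w ->
  phi (nseq m k ++ w) = phi w / m`!%:R.
Proof.
move=> kw.
have Uu : uniq (k :: undup w) by rewrite /= mem_undup kw undup_uniq.
rewrite !(@phiE (k :: undup w)) //; first last.
- by move=> x; rewrite mem_cat inE mem_undup mem_nseq => /orP[/andP[_ ->]|->];
    rewrite ?orbT.
- by move=> x; rewrite inE mem_undup => ->; rewrite orbT.
rewrite !big_cons -invfM -natrM count_cat count_nseq /= eqxx mul1n.
rewrite (count_memPn kw) addn0 fact0 mul1n mulnC; congr (_ * _)%:R^-1.
apply: eq_big_seq => x; rewrite mem_undup => wx.
rewrite count_cat count_nseq /=; case: eqP kw wx => [->|//].
by move/negPf->.
Qed.

(** For [d >= 1] this is [r * s_(d-1)], up to sign the skew form of the quiver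
    on the exponent vectors of the steps [k] and [k + d]; its value 1 at [d = 0]
    is what turns the product over a block of equal letters into a falling
    factorial. *)
Definition pairing (r : nat) (d : int) : int := s r d + s r (d - 2).

(** The exponent of the [k]-th wall function that remains after the wall
    functions of the later letters [w] have been expanded. *)
Definition block_exponent (r n k : nat) (w : seq nat) : int :=
  s r (n%:Z - k%:Z) - \sum_(x <- w) pairing r (x%:Z - k%:Z).

Lemma prod_factor_cons r n x w :
  \prod_(0 <= i < size (x :: w)) factor r n (x :: w) i =
  block_exponent r n x w * \prod_(0 <= i < size w) factor r n w i.
Proof.
rewrite /= big_nat_recl //; congr (_ * _).
  rewrite /factor /= big_add1 /= /block_exponent; congr (_ - _).
  by rewrite [RHS](big_nth 0%N).
apply: eq_bigr => i _; rewrite /factor /=; congr (_ - _).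
by rewrite big_add1.
Qed.

Lemma block_exponent_cat r n m k j w :
  block_exponent r n j (nseq m k ++ w) =
  block_exponent r n j w - m%:Z * pairing r (k%:Z - j%:Z).
Proof.
rewrite /block_exponent big_cat big_nseq /=.
have -> p : iter m (+%R (p : int)) 0 = m%:Z * p.
  by elim: m => [|m /= ->]; rewrite ?mul0r // -add1n PoszD mulrDl mul1r.
by rewrite opprD addrA addrAC.
Qed.

(** The first block of [m] equal letters contributes one generalised binomial
    coefficient: inside the block the factors are [e - m + 1], ..., [e], and the
    permutation count supplies [1 / m!]. *)
Lemma coefficient_block r n m k w : k \notin w ->
  coefficient r n (nseq m k ++ w) =
  binz (block_exponent r n k w) m * coefficient r n w.
Proof.
move=> kw; rewrite /coefficient phi_block //.
have -> : \prod_(0 <= i < size (nseq m k ++ w)) factor r n (nseq m k ++ w) i =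
  (\prod_(i < m) (block_exponent r n k w - i%:Z))
   * \prod_(0 <= i < size w) factor r n w i.
  elim: m => [|m IH]; first by rewrite big_ord0 mul1r.
  rewrite -[nseq m.+1 k]/(k :: nseq m k) cat_cons prod_factor_cons IH.
  rewrite block_exponent_cat subrr (_ : pairing r 0 = 1) // mulr1.
  by rewrite big_ord_recr /= [X in _ = X * _]mulrC mulrA.
by rewrite intrM /binz; ring.
Qed.

(** * Enumeration of weakly increasing words *)

Section Words.
Variables (D n : nat).
Local Open Scope nat_scope.

(** The weakly increasing words with letters in [n - d + 1 .. n], each used
    fewer than [D] times, built by prepending blocks of ever smaller letters: the
    order in which the wall functions get expanded. *)
Fixpoint words (d : nat) : seq (seq nat) :=
  if d is d'.+1
  then [seq nseq m (n - d') ++ w | w <- words d', m <- iota 0 D]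
  else [:: [::]].

Lemma words_sound d w : w \in words d -> d <= n ->
  sorted leq w /\ {in w, forall x, n - d < x <= n}.
Proof.
elim: d w => [|d IH] w /=; first by rewrite inE => /eqP->.
case/allpairsPdep=> v [m [/IH{}IH _ ->]] ltdn.
have [sv lv] := IH (ltnW ltdn); split.
  apply: (@path_sorted _ _ (n - d)); elim: m => [|m IHm] /=.
    rewrite path_sortedE ?sv ?andbT; last exact: leq_trans.
    by apply/allP => x /lv; lia.
  by rewrite leqnn.
move=> x; rewrite mem_cat mem_nseq => /orP[/andP[_ /eqP->]|/lv]; lia.
Qed.

Lemma words_fresh d w : w \in words d -> d < n -> (n - d) \notin w.
Proof.
move=> hw ltdn; have [_ lw] := words_sound hw (ltnW ltdn).
by apply/negP => /lw; rewrite ltnn.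
Qed.

Lemma words_uniq d : d <= n -> uniq (words d).
Proof.
elim: d => [//|d IH] ltdn /=.
apply: allpairs_uniq; rewrite ?iota_uniq ?IH // 1?ltnW //.
move=> _ _ /allpairsP[[v m] /= [hv _ ->]] /allpairsP[[v' m'] /= [hv' _ ->]] /= E.
have := congr1 (count_mem (n - d)) E.
rewrite !count_cat !count_nseq /= eqxx !mul1n !(count_memPn _) ?words_fresh //.
rewrite !addn0 => Em; move: E; rewrite Em => /eqP.
by rewrite eqseq_cat // eqxx => /eqP->.
Qed.

Lemma sorted_block k (w : seq nat) : sorted leq w -> {in w, forall x, k <= x} ->
  w = nseq (count_mem k w) k ++ [seq x <- w | k < x].
Proof.
elim: w => //= x w IH pw lw.
have lex : k <= x by apply: lw; rewrite mem_head.
have {}IH := IH (path_sorted pw) (fun y wy => lw y (mem_behead (s := x :: w) wy)).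
have [Dx|nx] := eqVneq x k; first by rewrite Dx ltnn add1n /= -Dx in IH *; rewrite -IH.
have ltkx : k < x by rewrite ltn_neqAle eq_sym nx.
have lt_w : {in w, forall y, k < y}.
  move=> y wy; apply: leq_trans ltkx _.
  by have /allP/(_ y wy) := order_path_min leq_trans pw.
rewrite ltkx add0n (_ : count_mem k w = 0) ?(all_filterP _) //; first exact/allP.
by apply/count_memPn/negP => /lt_w; rewrite ltnn.
Qed.

Lemma words_complete d w : d <= n -> sorted leq w ->
  {in w, forall x, n - d < x <= n} -> size w < D -> w \in words d.
Proof.
elim: d w => [|d IH] w ledn sw lw szw.
  by case: w lw {sw szw} => // x w /(_ x (mem_head _ _)); lia.
rewrite [w](@sorted_block (n - d)) //; last by move=> x /lw; lia.
apply/allpairsPdep; eexists; eexists; split; last reflexivity.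
  apply: IH; first exact: ltnW.
  - by apply: sorted_filter; [apply: leq_trans|].
  - by move=> x; rewrite mem_filter => /andP[-> /lw]; lia.
  by apply: leq_ltn_trans szw; rewrite size_filter count_size.
by rewrite mem_iota /= add0n; apply: leq_ltn_trans szw; rewrite count_size.
Qed.

End Words.

(** * Divisibility by an exchange binomial *)

Section Divisibility.
Variable N : nat.
Implicit Types p q g : {mpoly rat[N]}.

Lemma mcoeffMX_nle p (m k : 'X_{1..N}) : ~~ (m <= k)%MM -> ('X_[m] * p)@_k = 0.
Proof.
move=> nle; rewrite mcoeffM big1 // => j /eqP Dk; rewrite mcoeffX.
case: eqP => [Dm|_]; last by rewrite mul0r.
have le_add (a b : 'X_{1..N}) : k = (a + b)%MM -> (a <= k)%MM.
  by move->; apply: lem_addr.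
by have := le_add _ _ Dk; rewrite -Dm (negPf nle).
Qed.

Lemma monomial_divides (m : 'X_{1..N}) q :
  (forall k, ~~ (m <= k)%MM -> q@_k = 0) -> exists q', q = 'X_[m] * q'.
Proof.
move=> hq; exists (\sum_(k <- msupp q) q@_k *: 'X_[k - m]).
rewrite {1}[q]mpolyE big_distrr /=; apply: eq_big_seq => k kq.
rewrite -scalerAr -mpolyXD addmC submK //.
by apply: contraLR kq => /hq/eqP; rewrite mcoeff_eq0.
Qed.

(** A polynomial with constant coefficient 1 is coprime to every monomial. As
    [q = 'X_[m] * g + (1 - p) * q] and [1 - p] has no constant term, the
    coefficients of [q] outside the ideal of ['X_[m]] vanish by induction on the
    degree. *)
Lemma monomial_cancel (m : 'X_{1..N}) p q g :
  p@_0%MM = 1 -> p * q = 'X_[m] * g -> exists q', p * q' = g.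
Proof.
move=> p0 E; have [q' Dq] : exists q', q = 'X_[m] * q'.
  apply: monomial_divides => k.
  have Dq : q = 'X_[m] * g + (1 - p) * q by rewrite -E; ring.
  elim: {k}(mdeg k).+1 {-2}k (leqnn (mdeg k).+1) => // d IH k ltkd nle.
  rewrite Dq mcoeffD mcoeffMX_nle // add0r mcoeffM big1 // => j /eqP Dk.
  have [j0|nz] := eqVneq (bmnm j.1) 0%MM.
    by rewrite j0 mcoeffB mcoeff1 eqxx p0 subrr mul0r.
  have step (a b : 'X_{1..N}) : a != 0%MM -> k = (a + b)%MM -> q@_b = 0.
    move=> nza Dkab; apply: IH.
      move: ltkd; rewrite Dkab mdegD -mdeg_eq0 in nza *; lia.
    apply: contra nle => /mnm_lepP le_mb; apply/mnm_lepP => i.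
    by rewrite Dkab mnmDE (leq_trans (le_mb i)) // leq_addl.
  by rewrite [q@__](step _ _ nz Dk) mulr0.
exists q'; apply: (@mulfI _ 'X_[m]); last by rewrite -E Dq; ring.
by apply/eqP => /(congr1 (mcoeff m)); rewrite mcoeffX eqxx mcoeff0.
Qed.

(** The Laurent phenomenon in rank two. Modulo [F2] one has [F1^r = - z1] and
    [(F3 F1)^r = z2^r = z1 z3], hence [z1 * (F3^r + z3)] is
    [- (F3 F1)^r + z1 z3 = 0]. *)
Lemma exchange_divides (r : nat) (F0 F1 F2 F3 z1 z2 z3 : {mpoly rat[N]}) :
  F2 * F0 = F1 ^+ r + z1 -> F3 * F1 = F2 ^+ r + z2 -> z1 * z3 = z2 ^+ r ->
  exists q, F2 * q = z1 * (F3 ^+ r + z3).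
Proof.
move=> E1 E2 Ez.
have [A DA] : exists A, (F2 ^+ r + z2) ^+ r = z2 ^+ r + F2 * A.
  case: r {E1 E2 Ez} => [|r]; first by exists 0; rewrite !expr0; ring.
  exists (F2 ^+ r * \sum_(i < r.+1) (F2 ^+ r.+1 + z2) ^+ (r - i) * z2 ^+ i).
  have := subrXX (F2 ^+ r.+1 + z2) z2 r.+1; rewrite addrK => /(canRL (subrK _)).
  by move=> ->; rewrite mulrA -exprS [RHS]addrC.
exists (F0 * F3 ^+ r - A).
rewrite mulrBr mulrA E1.
have -> : F2 * A = F3 ^+ r * F1 ^+ r - z2 ^+ r by rewrite -exprMn E2 DA; ring.
by rewrite -Ez; ring.
Qed.

End Divisibility.

(** * The exchange recurrence and its product formula *)

(** The recurrence on all of [int]: extending [s] by zero costs a delta. *)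
Lemma s_recE r (z : int) :
  s r (z + 1) = r%:Z * s r z - s r (z - 1) + (z == -1)%:R.
Proof.
case: (ltrP z (-1)) => [lt|]; first by rewrite !s_neg ?lt_eqF //; lia.
rewrite le_eqVlt => /orP[/eqP <-|lt]; first by rewrite mulr0.
have -> : z + 1 = (z - 1) + 2 by lia.
rewrite s_rec; last by lia.
by rewrite subrK gt_eqF //; lia.
Qed.

Lemma pairingE r (d : int) : 0 < d -> pairing r d = r%:Z * s r (d - 1).
Proof.
move=> d0; rewrite /pairing; have := s_recE r (d - 1).
rewrite subrK gt_eqF; last by lia.
by rewrite (_ : d - 1 - 1 = d - 2) => [->|]; [rewrite addr0 subrK | lia].
Qed.

Definition ymonomial (r k : nat) : 'X_{1..2} :=
  [multinom `|s r (k%:Z - 1 - (nat_of_ord i)%:Z)|%N | i < 2].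

(** The recurrence is invertible. *)
Lemma s_pair_neq0 r m : s_pair r m != (0, 0).
Proof.
elim: m => //= m; case: (s_pair r m) => a b; apply: contra.
by rewrite !xpair_eqE => /andP[/eqP-> ]; rewrite mulr0 sub0r oppr_eq0 => ->.
Qed.

Lemma ymonomial_neq0 r k : (0 < k)%N -> ymonomial r k != 0%MM.
Proof.
case: k => // k _; apply/eqP => /mnmP y0.
have [E1 E2] : s r k%:Z = 0 /\ s r (k%:Z - 1) = 0.
  have := y0 v1; have := y0 v2; rewrite !mnmE => /eqP + /eqP.
  rewrite !absz_eq0 (_ : _ - (v1 : nat)%:Z = k); last by rewrite /=; lia.
  by rewrite (_ : _ - (v2 : nat)%:Z = k%:Z - 1) => [/eqP-> /eqP->|]; [|rewrite /=; lia].
case: k E1 E2 {y0} => [//|k]; rewrite (_ : k.+1%:Z - 1 = k); last by lia.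
have := s_pair_neq0 r k.+1; rewrite /s /=.
case: (s_pair r k) => a b /=; rewrite xpair_eqE => + E1 E2.
by rewrite E1 E2 !eqxx.
Qed.


Local Notation poly := {mpoly rat[2]}.
Local Notation K := {fraction poly}.

Definition yterm (r k : nat) : poly := 'X_[ymonomial r k].

(** Starting from (F_{-1}, F_0) = (1, 1) makes the exchange relation produce F_1
    as well, which is why the sequence below is shifted by one. *)
Fixpoint exchange_pair (r t : nat) : K * K :=
  if t is t'.+1
  then let: (a, b) := exchange_pair r t' in
       (b, (b ^+ r + tofrac (yterm r t)) / a)
  else (1, 1).

(** F_{t-1}. *)
Definition prevF (r t : nat) : K := (exchange_pair r t).1.

(** L_j = F_j F_{j-2} / F_{j-1}^r. *)
Definition wall_function (r j : nat) : K := prevF r j.+1 * prevF r j.-1 / prevF r j ^+ r.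

Section Recurrence.
Variables r n : nat.
Hypothesis hs : forall m : nat, (m < n)%N -> 0 <= s r m%:Z.

Lemma s_ge0_lt (z : int) : z < n%:Z -> 0 <= s r z.
Proof. by case: z => [m|m] // ?; apply: hs. Qed.

(** Nonnegativity of [s] is needed here: the exponents are absolute values of
    the terms of a linear recurrence. *)
Lemma yterm_exchange k : (0 < k)%N -> (k.+2 <= n)%N ->
  yterm r k * yterm r k.+2 = yterm r k.+1 ^+ r.
Proof.
move=> k0 ltkn; rewrite /yterm -mpolyXD mpolyXn; congr 'X_[_].
apply/mnmP => i; rewrite mnmDE mulmnE !mnmE; apply/eqP; rewrite -eqz_nat; apply/eqP.
have i2 := ltn_ord i.
rewrite PoszD PoszM !gez0_abs ?s_ge0_lt; try lia.
have := s_recE r (k.+1%:Z - 1 - i%:Z); rewrite gt_eqF; last by lia.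
have -> : k.+1%:Z - 1 - i%:Z + 1 = k.+2%:Z - 1 - i%:Z by lia.
have -> : k.+1%:Z - 1 - i%:Z - 1 = k%:Z - 1 - i%:Z by lia.
by rewrite addr0 => ->; ring.
Qed.

Lemma yterm_coef0 k : (0 < k)%N -> (yterm r k)@_0%MM = 0.
Proof. by move=> k0; rewrite mcoeffX (negPf (ymonomial_neq0 _ k0)). Qed.

Lemma prevFSS t : prevF r t.+2 = (prevF r t.+1 ^+ r + tofrac (yterm r t.+1)) / prevF r t.
Proof. by rewrite /prevF /=; case: (exchange_pair r t). Qed.

(** Four consecutive terms give the next one: the exchange relations make the
    divisor F_{t+1} divide the new numerator times a monomial, and the constant
    coefficient 1 allows to cancel that monomial. *)
Lemma prevF_poly t : (t <= n.+1)%N ->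
  exists2 p : poly, prevF r t = tofrac p & p@_0%MM = 1.
Proof.
have step p0 p1 p k : prevF r k = tofrac p0 -> prevF r k.+1 = tofrac p1 ->
    p0@_0%MM = 1 -> p1@_0%MM = 1 -> p0 * p = p1 ^+ r + yterm r k.+1 ->
    prevF r k.+2 = tofrac p /\ p@_0%MM = 1.
  move=> E0 E1 h0 h1 Ep; split.
    rewrite prevFSS E1 E0 -tofracXn -tofracD -Ep tofracM mulrC mulKf //.
    exact: const1_neq0.
  have := congr1 (mcoeff 0%MM) Ep.
  by rewrite mcoeff0_mul h0 mul1r mcoeffD mcoeff0_exp h1 expr1n yterm_coef0 ?addr0.
elim/ltn_ind: t => t IH letn.
have e1 : 1 = tofrac 1 :> K by rewrite tofrac1.
have c1 : (1 : poly)@_0%MM = 1 := mcoeff0_one 2.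
case: t IH letn => [|[|[|[|t]]]] IH letn; [by exists 1 | by exists 1 | | |].
- have [|E c] := step 1 1 (1 + yterm r 1) 0%N e1 e1 c1 c1.
    by rewrite expr1n mul1r.
  by exists (1 + yterm r 1).
- have [p2 E2 c2] := IH 2 isT (ltnW letn).
  have [|E c] := step 1 p2 (p2 ^+ r + yterm r 2) 1%N e1 E2 c1 c2.
    by rewrite mul1r.
  by exists (p2 ^+ r + yterm r 2).
have rel k p0 p1 p2 : prevF r k = tofrac p0 -> prevF r k.+1 = tofrac p1 ->
    prevF r k.+2 = tofrac p2 -> p0@_0%MM = 1 -> p2 * p0 = p1 ^+ r + yterm r k.+1.
  move=> E0 E1 E2 c0; apply/eqP; rewrite -tofrac_eq; apply/eqP.
  rewrite tofracM tofracD tofracXn -E0 -E1 -E2 prevFSS divfK // E0.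
  exact: const1_neq0.
have [p0 E0 c0] := IH t ltac:(lia) ltac:(lia).
have [p1 E1 d1] := IH t.+1 ltac:(lia) ltac:(lia).
have [p2 E2 c2] := IH t.+2 ltac:(lia) ltac:(lia).
have [p3 E3 c3] := IH t.+3 ltac:(lia) ltac:(lia).
have [] := @exchange_divides _ r p0 p1 p2 p3 (yterm r t.+1) (yterm r t.+2) (yterm r t.+3).
- exact: rel.
- exact: rel.
- by apply: yterm_exchange; lia.
move=> q0 /(monomial_cancel c2)[q Eq].
have [E c] := step p2 p3 q t.+2 E2 E3 c2 c3 Eq.
by exists q.
Qed.

Lemma prevF_unit t : (t <= n.+1)%N -> principal_unit (prevF r t).
Proof.
by move=> /prevF_poly[p -> c]; exists p, 1; rewrite mcoeff0_one tofrac1 divr1.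
Qed.

Definition wall_term j : K := tofrac (yterm r j) / prevF r j ^+ r.

Lemma wall_term_small j : (0 < j <= n)%N -> vanishes 1 (wall_term j).
Proof.
case/andP=> j0 /leqW/prevF_poly[p Ep c]; exists (yterm r j), (p ^+ r).
rewrite /wall_term Ep tofracXn mcoeff0_exp c expr1n; split=> //.
by apply: low_order1; apply: yterm_coef0.
Qed.

Lemma wall_functionE j : (0 < j <= n)%N -> wall_function r j = 1 + wall_term j.
Proof.
case: j => // j /= lejn; rewrite /wall_function /wall_term prevFSS /=.
have nz0 : prevF r j != 0 by apply/principal_unit_neq0/prevF_unit; lia.
have nz1 : prevF r j.+1 != 0 by apply/principal_unit_neq0/prevF_unit; lia.
by rewrite (divfK nz0) mulrDl (divff (expf_neq0 r nz1)).
Qed.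

Lemma wall_function_unit j : (0 < j <= n)%N -> principal_unit (wall_function r j).
Proof.
by move=> hj; rewrite wall_functionE //; apply/principal_unit_add1/wall_term_small.
Qed.

(** Both sides satisfy the same second-order recursion: by definition F_{t+1} is
    [L_{t+1} F_t^r / F_{t-1}], and the exponents obey [s_(d+1) = r s_d - s_(d-1)]
    with the delta accounting for the new factor. *)
Lemma prevF_prod t : (t <= n.+1)%N ->
  prevF r t = \prod_(1 <= j < n.+1) wall_function r j ^ s r (t%:Z - 1 - j%:Z).
Proof.
elim/ltn_ind: t => -[|[|t]] IH letn.
1,2: by rewrite big_nat big1 // => j hj; rewrite s_neg ?expr0z //; lia.
have nz k : (k <= n.+1)%N -> prevF r k != 0.
  by move=> hk; apply/principal_unit_neq0/prevF_unit.
have Ft := IH t (leqnSn _) (ltnW (ltnW letn)).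
have Ft1 := IH t.+1 (leqnn _) (ltnW letn).
have -> : prevF r t.+2 = wall_function r t.+1 * prevF r t.+1 ^ r%:Z * prevF r t ^ (-1).
  rewrite /wall_function /= exprN1 -exprnP divfK ?expf_neq0 ?nz ?(ltnW letn) //.
  by rewrite mulfK // nz // ltnW // ltnW.
have -> : wall_function r t.+1 = \prod_(1 <= j < n.+1) wall_function r j ^ (j == t.+1)%:R.
  rewrite (bigD1_seq t.+1) ?iota_uniq ?mem_index_iota //= eqxx expr1z.
  by rewrite big1 ?mulr1 // => j /negPf->; rewrite expr0z.
have prodXz e (f : nat -> K) : (\prod_(1 <= j < n.+1) f j) ^ e =
    \prod_(1 <= j < n.+1) f j ^ e.
  apply: (big_morph (fun x : K => x ^ e)) => [x y|]; first exact: expfzMl.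
  exact: exp1rz.
rewrite Ft Ft1 !prodXz -!big_split /=; apply: eq_big_nat => j hj.
have nzj : wall_function r j != 0 by apply/principal_unit_neq0/wall_function_unit; lia.
rewrite !exprz_exp -!expfzDr //; congr (_ ^ _).
have -> : t.+2%:Z - 1 - j%:Z = t.+1%:Z - j%:Z by lia.
have := s_recE r (t.+1%:Z - 1 - j%:Z).
have -> : t.+1%:Z - 1 - j%:Z + 1 = t.+1%:Z - j%:Z by lia.
have -> : t.+1%:Z - 1 - j%:Z - 1 = t%:Z - 1 - j%:Z by lia.
move=> ->; have -> : (t.+1%:Z - 1 - j%:Z == -1) = (j == t.+1) by lia.
by case: eqP => _; ring.
Qed.

End Recurrence.

(** * Seeds of the Kronecker quiver *)

Section KroneckerSeeds.
Variable r : nat.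

(** The seed after [t] steps. All arrows between base vertices leave the vertex
    that is mutated next; its c-vector is positive and is the exponent of the
    next y-monomial, while the vertex mutated last carries minus the previous
    exponent. The one exception is the initial seed, where the second vertex
    still receives the arrow from its own frozen vertex ([frozen_last]). *)
Record kronecker_seed (t : nat) (S : quiver ('I_2 + 'I_2)%type * ('I_2 + 'I_2 -> K)) :
    Prop := KroneckerSeed {
  next_label : S.2 (inl (alternating t.+1)) = prevF r t;
  last_label : S.2 (inl (alternating t)) = prevF r t.+1;
  frozen_label : forall i, S.2 (inr i) = tofrac 'X_i;
  next_last : S.1 (inl (alternating t.+1)) (inl (alternating t)) = r;
  last_next : S.1 (inl (alternating t)) (inl (alternating t.+1)) = 0%N;
  loopless : forall i, S.1 (inl i) (inl i) = 0%N;
  frozen_frozen : forall i j, S.1 (inr i) (inr j) = 0%N;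
  frozen_next : forall i, S.1 (inr i) (inl (alternating t.+1)) = ymonomial r t.+1 i;
  next_frozen : forall i, S.1 (inl (alternating t.+1)) (inr i) = 0%N;
  frozen_last : forall i, S.1 (inr i) (inl (alternating t)) = (t%:Z - i%:Z == -1);
  last_frozen : forall i, S.1 (inl (alternating t)) (inr i) = ymonomial r t i }.

Lemma alternatingSS t : alternating t.+2 = alternating t.
Proof. by rewrite /alternating /= negbK. Qed.

Lemma alternating_neq t : (alternating t == alternating t.+1) = false.
Proof. by rewrite /alternating /=; case: (odd t). Qed.

Lemma big_alternating (R : comNzRingType) (f : 'I_2 -> R) t :
  \prod_(i < 2) f i = f (alternating t.+1) * f (alternating t).
Proof.
rewrite (bigD1 (alternating t.+1)) // (bigD1 (alternating t)) ?alternating_neq //=.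
rewrite big1 ?mulr1 // /alternating => -[[|[|//]] lt] /=; case: (odd t) => //=.
Qed.

Lemma kronecker_seed0 :
  kronecker_seed 0 (framed (kronecker r), @initial_labels 2).
Proof.
split => //=.
- by case=> [[|[|//]] lt].
- by case=> [[|[|//]] lt]; rewrite mnmE.
- by case=> [[|[|//]] lt].
- by move=> i; rewrite mnmE s_neg //; have := ltn_ord i; lia.
Qed.

Lemma mutated_label t S : kronecker_seed t S ->
  (mutate (inl (alternating t.+1)) S).2 (inl (alternating t.+1)) = prevF r t.+2.
Proof.
move=> H; rewrite /= /mutate_labels eqxx.
rewrite !big_sumType /= !(big_alternating _ t) /=.
rewrite !(loopless H) (last_next H) (next_last H) (next_label H) (last_label H).
rewrite !(next_frozen H) !(frozen_label H) !(frozen_next H) !expr0 !mulr1 !mul1r.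
rewrite -!tofracXn -tofracM prevFSS /yterm.
rewrite [X in _ = (_ + tofrac X) / _]mpolyXE_id (big_alternating _ t).
by rewrite [in RHS]addrC.
Qed.

(** Mutation adds [r] times the positive c-vector to the negative one, which is
    the recurrence of [s]; nonnegativity of the result says on which side the
    arrows survive the deletion of 2-cycles. *)
Lemma kronecker_seedS n t S : (forall m : nat, (m < n)%N -> 0 <= s r m%:Z) ->
  (t.+1 < n)%N -> kronecker_seed t S ->
  kronecker_seed t.+1 (mutate (inl (alternating t.+1)) S).
Proof.
move=> hs lttn H; have M := mutated_label H.
have ab : (alternating t == alternating t.+1) = false := alternating_neq t.
have ba : (alternating t.+1 == alternating t) = false by rewrite eq_sym.
(* The delta is the arrow of the initial seed noted in [frozen_last]. *)
have recE (i : 'I_2) :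
    ((t%:Z - i%:Z == -1)%R + ymonomial r t.+1 i * r =
     ymonomial r t.+2 i + ymonomial r t i)%N.
  apply/eqP; rewrite -eqz_nat; apply/eqP; rewrite !mnmE !PoszD PoszM.
  have ss k : (k < n)%N -> `|s r (k%:Z - i%:Z)|%N = s r (k%:Z - i%:Z) :> int.
    by move=> ltkn; rewrite gez0_abs // (s_ge0_lt hs) //; lia.
  rewrite (_ : t.+1%:Z - 1 - i%:Z = t%:Z - i%:Z); last by lia.
  rewrite (_ : t.+2%:Z - 1 - i%:Z = t.+1%:Z - i%:Z); last by lia.
  rewrite !ss ?(ltnW lttn) // gez0_abs ?(s_ge0_lt hs) //; last by lia.
  rewrite (_ : t.+1%:Z - i%:Z = t%:Z - i%:Z + 1); last by lia.
  rewrite s_recE (_ : t%:Z - i%:Z - 1 = t%:Z - 1 - i%:Z); last by lia.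
  by case: (_ == _); ring.
split; rewrite ?alternatingSS //.
- by rewrite /= /mutate_labels /= (inj_eq inl_inj) ab (last_label H).
- by move=> i; rewrite /= /mutate_labels /= (frozen_label H).
- rewrite /= /mutate_quiver /delete_2cycles /reverse_at /add_paths !(inj_eq inl_inj).
  by rewrite eqxx orbT /= (next_last H) (last_next H) !(loopless H) muln0 subn0 addn0.
- rewrite /= /mutate_quiver /delete_2cycles /reverse_at /add_paths !(inj_eq inl_inj).
  by rewrite eqxx orbT /= (next_last H) (last_next H) !(loopless H) !muln0 mul0n sub0n.
- by move=> i; rewrite /= /mutate_quiver /delete_2cycles subnn.
- move=> i j; rewrite /= /mutate_quiver /delete_2cycles /reverse_at /add_paths /=.
  by rewrite !(frozen_frozen H) !(next_frozen H) !muln0.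
- move=> i; rewrite /= /mutate_quiver /delete_2cycles /reverse_at /add_paths /=.
  rewrite !(inj_eq inl_inj) ab /= (frozen_last H) (last_frozen H) (frozen_next H).
  by rewrite (next_last H) (last_next H) mul0n addn0 recE addnK.
- move=> i; rewrite /= /mutate_quiver /delete_2cycles /reverse_at /add_paths /=.
  rewrite !(inj_eq inl_inj) ab /= (frozen_last H) (last_frozen H) (frozen_next H).
  rewrite (next_last H) (last_next H) mul0n addn0 recE.
  by apply/eqP; rewrite subn_eq0 leq_addl.
- move=> i; rewrite /= /mutate_quiver /delete_2cycles /reverse_at /add_paths /=.
  rewrite !(inj_eq inl_inj) eqxx /= (frozen_next H) (next_frozen H).
  rewrite !(loopless H) mul0n sub0n.
  by rewrite gt_eqF //; have := ltn_ord i; lia.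
- move=> i; rewrite /= /mutate_quiver /delete_2cycles /reverse_at /add_paths /=.
  rewrite !(inj_eq inl_inj) eqxx /= (frozen_next H) (next_frozen H).
  by rewrite !(loopless H) muln0 mul0n !addn0 subn0.
Qed.

End KroneckerSeeds.

Lemma Fpoly_prevF r n : (0 < n)%N ->
  (forall m : nat, (m < n)%N -> 0 <= s r m%:Z) ->
  Fpoly (kronecker r) alternating n = prevF r n.+1.
Proof.
case: n => // n _ hs; rewrite /Fpoly; apply: mutated_label.
suff H t : (t < n.+1)%N -> kronecker_seed r t (seed_after (kronecker r) alternating t).
  exact: H.
elim: t => [|t IH] lttn; first exact: kronecker_seed0.
exact: (kronecker_seedS hs lttn (IH (ltnW lttn))).
Qed.

(** * Expansion of the product formula *)

Section Expansion.
Variables r n D : nat.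
Hypothesis hs : forall m : nat, (m < n)%N -> 0 <= s r m%:Z.

Definition word_monomial (w : seq nat) : 'X_{1..2} :=
  (\sum_(x <- w) ymonomial r x)%MM.

Lemma word_monomial_block m k w :
  'X_[word_monomial (nseq m k ++ w)] = yterm r k ^+ m * 'X_[word_monomial w] :> poly.
Proof.
rewrite /word_monomial big_cat mpolyXD /yterm mpolyXn; congr ('X_[_] * _).
by rewrite big_nseq; elim: m => [|m /= ->]; rewrite ?mulm0n // mulmS.
Qed.

(** Here the wall functions become recursive: [u_k = z_k / F_{k-1}^r], and F_{k-1}
    is itself a product of the earlier wall functions. *)
Lemma wall_term_prod k : (0 < k <= n)%N ->
  wall_term r k = tofrac (yterm r k) *
    \prod_(1 <= j < k) wall_function r j ^ (- pairing r (k%:Z - j%:Z)).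
Proof.
case: k => // k /= lekn; rewrite /wall_term; congr (_ * _).
have hs' m : (m < k)%N -> 0 <= s r m%:Z.
  by move=> ltmk; apply: hs; apply: leq_trans ltmk (ltnW lekn).
rewrite (prevF_prod hs' (leqnn _)) -[_ ^+ r]/(_ ^ r%:Z) invr_expz.
rewrite (big_morph (fun x : K => x ^ (- r%:Z)) (fun x y => expfzMl x y _) (exp1rz _ _)).
apply: eq_big_nat => j hj; rewrite exprz_exp pairingE; last by lia.
by congr (_ ^ _); rewrite mulrN mulrC addrAC.
Qed.

(** The contribution of [w] once the wall functions L_j with [j > n - d] have
    been expanded and the others are still intact. *)
Definition partial_term (d : nat) (w : seq nat) : K :=
  constF 2 (coefficient r n w) * tofrac 'X_[word_monomial w] *
  \prod_(1 <= j < (n - d)%N.+1) wall_function r j ^ block_exponent r n j w.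

(** The [m]-th term of the binomial series of L_{n-d} splits into a monomial, a
    binomial coefficient and powers of earlier wall functions; these are exactly
    the changes that prepending [m] letters [n - d] causes. *)
Lemma partial_term_block d w m : (d < n)%N -> (n - d)%N \notin w ->
  partial_term d.+1 (nseq m (n - d)%N ++ w) =
  constF 2 (coefficient r n w) * tofrac 'X_[word_monomial w] *
  (\prod_(1 <= j < (n - d)%N) wall_function r j ^ block_exponent r n j w) *
  (constF 2 (binz (block_exponent r n (n - d)%N w) m) * wall_term r (n - d)%N ^+ m).
Proof.
move=> ltdn fresh; rewrite /partial_term coefficient_block // word_monomial_block.
have -> : (n - d.+1)%N.+1 = (n - d)%N by lia.
have -> : \prod_(1 <= j < (n - d)%N)
      wall_function r j ^ block_exponent r n j (nseq m (n - d)%N ++ w) =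
    \prod_(1 <= j < (n - d)%N) wall_function r j ^ block_exponent r n j w *
    (\prod_(1 <= j < (n - d)%N)
       wall_function r j ^ (- pairing r ((n - d)%N%:Z - j%:Z))) ^+ m.
  rewrite -prodrXl -big_split /=; apply: eq_big_nat => j hj.
  have nz : wall_function r j != 0.
    by apply/principal_unit_neq0/(wall_function_unit hs); lia.
  rewrite block_exponent_cat /= -[_ ^+ m]/(_ ^ m%:Z) exprz_exp -expfzDr //.
  by congr (_ ^ _); ring.
rewrite wall_term_prod; last by lia.
by rewrite exprMn constFM tofracM tofracXn; ring.
Qed.

Lemma partial_term_expand d w : (d < n)%N -> w \in words D.+1 n d ->
  vanishes D.+1 (partial_term d w -
    \sum_(m <- iota 0 D.+1) partial_term d.+1 (nseq m (n - d)%N ++ w)).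
Proof.
move=> ltdn hw; have fresh := words_fresh hw ltdn.
under eq_bigr do rewrite partial_term_block //.
rewrite -big_distrr {1}/partial_term big_nat_recr /=; last by lia.
rewrite mulrA -mulrBr; apply: vanishesMl.
  do 2?[apply: vanishesMl]; try exact: vanishes_poly.
  apply/principal_unit_vanishes; apply: principal_unit_prod => j.
  rewrite mem_index_iota => hj; apply/principal_unit_exprz/(wall_function_unit hs); lia.
rewrite (wall_functionE hs); last by lia.
rewrite -[0%N :: iota 1 D]/(iota 0 D.+1).
rewrite (_ : iota 0 D.+1 = index_iota 0 D.+1) ?big_mkord; last first.
  by rewrite /index_iota subn0.
by apply: binomial_expansion; apply: (wall_term_small hs); lia.
Qed.

(** Expanding the wall functions one after the other, the last one first. *)
Lemma prevF_expansion d : (d <= n)%N ->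
  vanishes D.+1 (prevF r n.+1 - \sum_(w <- words D.+1 n d) partial_term d w).
Proof.
elim: d => [_|d IH ltdn].
  rewrite big_seq1 /partial_term subn0 (prevF_prod hs) //.
  have -> : coefficient r n [::] = 1.
    by rewrite /coefficient /phi big_nil /= mulr1 divr1.
  rewrite constF1 /word_monomial big_nil mpolyX0 tofrac1 !mul1r.
  rewrite [X in _ - X](eq_bigr (fun j => wall_function r j ^ s r (n.+1%:Z - 1 - j%:Z))).
    by rewrite subrr; apply: vanishes0.
  move=> j _; rewrite /block_exponent big_nil subr0.
  by rewrite (_ : n.+1%:Z - 1 = n%:Z) //; lia.
set S := \sum_(w <- words D.+1 n d) partial_term d w.
rewrite -(subrK S (prevF _ _)) -addrA; apply: vanishesD; first exact/IH/ltnW.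
rewrite -[words _ _ d.+1]/([seq nseq m (n - d)%N ++ w |
  w <- words D.+1 n d, m <- iota 0 D.+1]) big_allpairs_dep /= -sumrB.
by apply: vanishes_sum => w hw; apply: partial_term_expand.
Qed.

End Expansion.

(** * The power series formula *)

Section Exponents.
Variables r n : nat.
Hypothesis hs : forall m : nat, (m < n)%N -> 0 <= s r m%:Z.

Lemma word_monomial_exponent (w : seq nat) (i : 'I_2) :
  {in w, forall x, (x <= n)%N} ->
  (word_monomial r w i)%:Z = \sum_(x <- w) s r (x%:Z - 1 - (nat_of_ord i)%:Z).
Proof.
move=> hw; rewrite /word_monomial mnm_sumE.
rewrite (big_morph Posz PoszD (erefl _)); apply: eq_big_seq => x /hw lexn.
by rewrite mnmE gez0_abs // (s_ge0_lt hs) //; lia.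
Qed.

Lemma word_monomialP (w : seq nat) (m : 'X_{1..2}) :
  {in w, forall x, (x <= n)%N} ->
  (exponent1 r w == (m v1)%:Z) && (exponent2 r w == (m v2)%:Z) =
  (word_monomial r w == m).
Proof.
move=> hw.
have -> : exponent1 r w = (word_monomial r w v1)%:Z.
  by rewrite word_monomial_exponent //; apply: eq_bigr => x _; rewrite subr0.
have -> : exponent2 r w = (word_monomial r w v2)%:Z.
  rewrite word_monomial_exponent //; apply: eq_bigr => x _.
  by congr (s r _); rewrite /=; lia.
rewrite !eqz_nat; apply/andP/eqP => [[/eqP e1 /eqP e2]|->] //.
apply/mnmP => -[[|[|//]] lt].
  by rewrite (_ : Ordinal lt = v1) //; apply: val_inj.
by rewrite (_ : Ordinal lt = v2) //; apply: val_inj.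
Qed.

(** Each letter contributes a nontrivial monomial, so only finitely many words
    have a given exponent. *)
Lemma size_le_mdeg (w : seq nat) : {in w, forall x, (0 < x)%N} ->
  (size w <= mdeg (word_monomial r w))%N.
Proof.
move=> hw; rewrite /word_monomial mdeg_sum -sum1_size.
rewrite [leqRHS]big_seq big_seq; apply: leq_sum => x /hw x0.
by rewrite lt0n mdeg_eq0 ymonomial_neq0.
Qed.

End Exponents.

(* The last hypothesis says that every y-exponent in the formula is
   nonnegative; by s_ge0 it holds for all n as soon as r >= 2. *)
Theorem theorem4p6 (r n : nat) (hn : (1 <= n)%N)
    (hs : forall m : nat, (m < n)%N -> 0 <= s r m%:Z) :
  exists p : {mpoly rat[2]},
    Fpoly (kronecker r) alternating n = tofrac p /\
    is_power_series_sum (in_W n) (coefficient r n)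
      (exponent1 r) (exponent2 r) p.
Proof.
have [p Ep _] := prevF_poly hs (leqnn n.+1).
exists p; split; first by rewrite Fpoly_prevF.
move=> m; set D := mdeg m.
have in_W_n w : w \in words D.+1 n n -> in_W n w.
  move=> /words_sound[] // sw lw; rewrite /in_W sw.
  by apply/allP => x /lw; rewrite subnn.
(* A word of monomial [m] has at most [mdeg m] letters, so multiplicities below
   [D.+1] suffice. *)
exists [seq w <- words D.+1 n n | word_monomial r w == m]; split.
- by rewrite filter_uniq // words_uniq.
- move=> w; rewrite mem_filter inE; apply/idP/idP.
    move=> /andP[wm /in_W_n hw]; rewrite hw (word_monomialP hs) //.
    by case/andP: hw => _ /allP hw x /hw/andP[].
  move=> /andP[/andP[sw /allP lw]].
  rewrite (word_monomialP hs) => [wm|x /lw/andP[//]].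
  rewrite wm words_complete // => [x /lw|]; first by rewrite subnn.
  by rewrite ltnS /D -(eqP wm) size_le_mdeg // => x /lw/andP[].
have := prevF_expansion D hs (leqnn n).
rewrite Ep (eq_bigr (fun w => tofrac (coefficient r n w *: 'X_[word_monomial r w]))).
  rewrite -rmorph_sum -tofracB => /vanishes_tofracP/(_ m (ltnSn _)).
  rewrite mcoeffB => /eqP; rewrite subr_eq0 => /eqP ->.
  rewrite raddf_sum big_filter [LHS]big_mkcond; apply: eq_bigr => w _ /=.
  by rewrite mcoeffZ mcoeffX; case: eqP => _; rewrite ?mulr1 ?mulr0.
move=> w _; rewrite /partial_term subnn big_geq // mulr1 -tofracM.
by rewrite mul_mpolyC.
Qed.
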